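(* Let $(\vec b_1,\dots,\vec b_d)$ be a lattice basis and let $i$ be such that $\|\vec b_j^*\|\le\|\vec b_1\|/\sqrt d$ for all $j\ge i$. Then the number of points considered by Kannan's algorithm on this basis is at least \[ 2^{-d+i-1}\prod_{j\ge i}\frac{\|\vec b_1\|}{\sqrt d\,\|\vec b_j^*\|}. \] In particular, if the input is, for each $d$, the HKZ-reduced basis $(\vec b_1,\dots,\vec b_d)$ with $\|\vec b_i^*\|=\sqrt{d-i+1}\prod_{l=i+1}^d(C(d-l+2))^{\frac{1}{2(d-l+1)}}$ for $C=e^{-6}$, then Kannan's algorithm performs at least $d^{\frac{d}{2e}(1+o(1))}$ operations as $d\to\infty$.
   Context: Gram–Schmidt vectors: $\vec b_i^*=\vec b_i-\sum_{j<i}\mu_{i,j}\vec b_j^*$, $\mu_{i,j}=\langle\vec b_i,\vec b_j^*\rangle/\|\vec b_j^*\|^2$; $\vec b_i(j)$ is the projection of $\vec b_i$ orthogonally to $\vec b_1,\dots,\vec b_{j-1}$. A basis is HKZ-reduced if $\vec b_1$ is a shortest nonzero lattice vector and recursively $(\vec b_2(2),\dots,\vec b_d(2))$ is HKZ-reduced. Kannan's algorithm HKZ-reduces a basis as follows: it first quasi-HKZ-reduces it (so that $\|\vec b_1\|\le2\|\vec b_2^*\|$ and $(\vec b_2(2),\dots,\vec b_d(2))$ is HKZ-reduced; this does nothing on an HKZ-reduced input), then finds all integer $(x_1,\dots,x_d)$ with $\|\sum_i x_i\vec b_i\|\le\|\vec b_1\|$ by enumerating, for each $i$ from $d$ down to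 $1$, all integer points $(x_i,\dots,x_d)$ with $\|\sum_{j\ge i}x_j\vec b_j(i)\|\le\|\vec b_1\|$ (each such point costs at least one operation); the points considered are these enumerated integer points. Existence of the bases in the ''in particular'' part is guaranteed.
   Formalization: In the first claim, ''points considered on this basis'' means the points enumerated on the given basis itself, without the preliminary quasi-HKZ-reduction; counted after that reduction the bound fails, e.g. for b_1=(M,0), b_2=(0,1), i=2, M large. *)

(* Defs.v *)
(* MathComp-Analysis.  A d-tuple of vectors of R^n is a matrix B : 'M[R]_(d, n)
   with rows b_1, ..., b_d; it is a lattice basis when it is row_free.
   Row indices start at 0, so row i B is b_{i+1}. *)
From HB Require Import structures.
From mathcomp Require Import all_boot all_order all_algebra.
From mathcomp Require Import finmap.
From mathcomp Require Import all_classical all_reals all_analysis.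

Set Implicit Arguments.
Unset Strict Implicit.
Unset Printing Implicit Defensive.

Import Order.TTheory GRing.Theory Num.Theory.

Local Open Scope classical_set_scope.
Local Open Scope ring_scope.

Section Euclidean.
Variables (R : realType) (n : nat).

Definition dot (u v : 'rV[R]_n) : R := \sum_k u 0 k * v 0 k.

(* The library norm `|u| on row vectors is the sup norm. *)
Definition enorm (u : 'rV[R]_n) : R := Num.sqrt (dot u u).

(* Right multiplication by orthoproj U is the orthogonal projection onto the
   orthogonal complement of the row space of U (see orthoprojP). *)
Definition orthoproj m (U : 'M[R]_(m, n)) : 'M[R]_n :=
  proj_mx (kermx U^T) <<U>>%MS.

End Euclidean.

Section Basis.
Variable R : realType.

Section AnyDim.
Variables d n : nat.
Implicit Types B : 'M[R]_(d, n).

Definition lattice B : set 'rV[R]_n :=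
  [set v | exists x : 'rV[int]_d, v = \sum_i (x 0 i)%:~R *: row i B].

(* Recursion on the fuel k; any k > i gives the same vector (see gsE). *)
Fixpoint gs_fuel B (k : nat) (i : 'I_d) : 'rV[R]_n :=
  if k is k'.+1 then
    row i B - \sum_(j < d | (j < i)%N)
      (dot (row i B) (gs_fuel B k' j) / enorm (gs_fuel B k' j) ^+ 2)
        *: gs_fuel B k' j
  else 0.

Definition gs B (i : 'I_d) : 'rV[R]_n := gs_fuel B i.+1 i.

Definition gs_mu B (i j : 'I_d) : R :=
  dot (row i B) (gs B j) / enorm (gs B j) ^+ 2.

Definition first_rows B (k : nat) : 'M[R]_(d, n) :=
  \matrix_(l < d) (if (l < k)%N then row l B else 0).

(* The rows are the projections of b_1, ..., b_d orthogonally to b_1, ..., b_k,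
   i.e. the vectors b_j(k+1). *)
Definition proj_basis B (k : nat) : 'M[R]_(d, n) :=
  B *m orthoproj (first_rows B k).

End AnyDim.

(* (b_2(2), ..., b_d(2)) *)
Definition tail_basis d n (B : 'M[R]_(d.+1, n)) : 'M[R]_(d, n) :=
  row' ord0 (proj_basis B 1).

Definition shortest_nonzero d n (B : 'M[R]_(d, n)) (u : 'rV[R]_n) : Prop :=
  [/\ lattice B u, u != 0 &
      forall v, lattice B v -> v != 0 -> enorm u <= enorm v].

Fixpoint HKZ d n : 'M[R]_(d, n) -> Prop :=
  if d is d'.+1 then
    fun B => shortest_nonzero B (row ord0 B) /\ HKZ (tail_basis B)
  else fun=> True.

(* The condition on b_2^* is void when d = 1. *)
Definition quasi_HKZ d n (B : 'M[R]_(d.+1, n)) : Prop :=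
  (forall i : 'I_d.+1, i = 1%N :> nat ->
     enorm (row ord0 B) <= 2 * enorm (gs B i)) /\
  HKZ (tail_basis B).

(* The integer points (x_i, ..., x_d), for i = d, ..., 1, visited by the
   enumeration of radius |b_1|.  Such a point is encoded by the pair of i and
   of (0, ..., 0, x_i, ..., x_d). *)
Definition enum_points d n (B : 'M[R]_(d.+1, n)) :
    set ('I_d.+1 * 'rV[int]_d.+1) :=
  [set p : 'I_d.+1 * 'rV[int]_d.+1 |
     (forall j : 'I_d.+1, (j < p.1)%N -> p.2 0 j = 0) /\
     enorm (\sum_(j < d.+1 | (p.1 <= j)%N)
              (p.2 0 j)%:~R *: row j (proj_basis B p.1))
       <= enorm (row ord0 B)].

(* fset_set sends an infinite set to the empty one, so that a positive lower
   bound on num_points also asserts that enum_points is finite. *)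
Definition num_points d n (B : 'M[R]_(d.+1, n)) : nat :=
  #|` fset_set (enum_points B) |%fset.

(* An implementation of Kannan's algorithm: the quasi-HKZ-reduction which
   precedes the enumeration, and the total number of operations on a given
   input, each enumerated point costing at least one operation. *)
Record kannan_algorithm := KannanAlgorithm {
  quasi_reduce : forall d n, 'M[R]_(d.+1, n) -> 'M[R]_(d.+1, n);
  operations : forall d n, 'M[R]_(d.+1, n) -> nat;
  quasi_reduceP : forall d n (B : 'M[R]_(d.+1, n)), row_free B ->
    [/\ row_free (quasi_reduce B), lattice (quasi_reduce B) = lattice B &
        quasi_HKZ (quasi_reduce B)];
  quasi_reduce_id : forall d n (B : 'M[R]_(d.+1, n)), row_free B ->
    HKZ B -> quasi_reduce B = B;
  operations_ge : forall d n (B : 'M[R]_(d.+1, n)), row_free B ->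
    (num_points (quasi_reduce B) <= operations B)%N
}.

(* The prescribed value of |b_i^*| in dimension d, with i counted from 1. *)
Definition bad_profile (d i : nat) : R :=
  let C := expR (- 6) in
  Num.sqrt (d - i + 1)%:R *
  \prod_(i + 1 <= l < d + 1)
    (C * (d - l + 2)%:R) `^ (1 / (2 * (d - l + 1)%:R)).

End Basis.

Section Sanity.
Variables (R : realType) (n : nat).

Lemma dotE (u v : 'rV[R]_n) : dot u v = (u *m v^T) 0 0.
Proof. by rewrite mxE; apply: eq_bigr => k _; rewrite mxE. Qed.

Lemma dot_eq0 (u : 'rV[R]_n) : dot u u = 0 -> u = 0.
Proof.
move=> /eqP; rewrite psumr_eq0 => [|k _]; last by rewrite -expr2 sqr_ge0.
move=> /allP u0; apply/rowP => k; rewrite mxE.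
by have := u0 k; rewrite mem_index_enum mulf_eq0 orbb => /(_ isT)/eqP.
Qed.

Lemma gsE d (B : 'M[R]_(d, n)) (i : 'I_d) :
  gs B i = row i B - \sum_(j < d | (j < i)%N) gs_mu B i j *: gs B j.
Proof.
have stable k l (j : 'I_d) : (j < k)%N -> (j < l)%N ->
    gs_fuel B k j = gs_fuel B l j.
  elim: k l j => [|k IH] [|l] j //= jk jl; congr (_ - _).
  apply: eq_bigr => h hj.
  by rewrite (IH l h) //; [exact: leq_trans hj jk | exact: leq_trans hj jl].
rewrite {1}/gs /=; congr (_ - _); apply: eq_bigr => j ji.
by rewrite /gs_mu /gs (stable i j.+1).
Qed.

Lemma kermx_cap0 m (U : 'M[R]_(m, n)) : (kermx U^T :&: <<U>> = 0)%MS.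
Proof.
apply/eqP/rowV0P => v; rewrite sub_capmx genmxE => /andP[/sub_kermxP vU].
move=> /submxP[D vE]; apply: dot_eq0.
by rewrite dotE [X in _ *m X^T]vE trmx_mul mulmxA vU mul0mx mxE.
Qed.

Lemma orthoprojP m (U : 'M[R]_(m, n)) (v : 'rV[R]_n) :
  (v - v *m orthoproj U <= U)%MS /\
  (forall u : 'rV[R]_n, (u <= U)%MS -> dot (v *m orthoproj U) u = 0).
Proof.
split; last first.
  move=> u /submxP[D ->]; rewrite dotE trmx_mul mulmxA.
  have /sub_kermxP -> := proj_mx_sub (kermx U^T) <<U>>%MS v.
  by rewrite mul0mx mxE.
suff full : row_full (kermx U^T + <<U>>)%MS.
  by have := proj_mx_compl_sub (submx_full v full); rewrite genmxE.
have := mxrank_sum_cap (kermx U^T) <<U>>%MS.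
rewrite kermx_cap0 mxrank0 addn0 /row_full => ->.
by rewrite mxrank_ker genmxE mxrank_tr subnK // rank_leq_col.
Qed.

End Sanity.

(* Main.v *)
(* Enumerated points of level i are the integer x supported on the indices >= i
   whose coordinates w_j = x_j + sum_(l > j) mu_(l,j) x_l satisfy
   sum_(j >= i) w_j^2 |b_j^*|^2 <= |b_1|^2.  With r_j = |b_1| / (sqrt d |b_j^*|),
   0 <= w_j <= r_j for all j >= i suffices, and choosing x_d, x_(d-1), ... in
   turn leaves at least floor r_j >= r_j / 2 possibilities for x_j.

   For the bad basis put L = ln d, m = d - j + 1 and T = L - ln m.  Comparing
   sum_q ln (q + 1) / q with (ln m)^2 / 2 gives
   ln r_j >= L (T - 1) / 2 - T^2 / 4 - 11 T / 2, which is nonnegative when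
   T >= 1 + 38 / L, i.e. for m up to about d / e.  Summing over these m with
   ln m! <= m ln m - m + O(ln m) and sum_m T^2 = O(d), the logarithm of the
   number of points is at least d L / (2 e) - 200 d; the correction is absorbed
   in eps d = - 400 e / ln d, and the claim is trivial when L <= 400 e. *)
Require Import Defs.
From HB Require Import structures.
From mathcomp Require Import all_boot all_order all_algebra.
From mathcomp Require Import finmap.
From mathcomp Require Import all_classical all_reals all_analysis.
From mathcomp Require Import ring lra zify.
Import Order.TTheory GRing.Theory Num.Theory.
Import numFieldNormedType.Exports.
Local Open Scope classical_set_scope.
Local Open Scope ring_scope.

Set Implicit Arguments.
Unset Strict Implicit.
Unset Printing Implicit Defensive.

(** * Inner product and Pythagoras' identity *)

Section Dot.
Variables (R : realType) (n : nat).
Implicit Types u v w : 'rV[R]_n.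

Lemma dotC u v : dot u v = dot v u.
Proof. by apply: eq_bigr => k _; rewrite mulrC. Qed.

Lemma dotDl u v w : dot (u + v) w = dot u w + dot v w.
Proof. by rewrite !dotE mulmxDl mxE. Qed.

Lemma dotBl u v w : dot (u - v) w = dot u w - dot v w.
Proof. by rewrite !dotE mulmxBl !mxE. Qed.

Lemma dotZl a u v : dot (a *: u) v = a * dot u v.
Proof. by rewrite !dotE -scalemxAl mxE. Qed.

Lemma dot0r u : dot u 0 = 0.
Proof. by rewrite dotE trmx0 mulmx0 mxE. Qed.

Lemma dot_suml I (r : seq I) (P : pred I) (F : I -> 'rV[R]_n) v :
  dot (\sum_(i <- r | P i) F i) v = \sum_(i <- r | P i) dot (F i) v.
Proof.
by rewrite dotE mulmx_suml summxE; apply: eq_bigr => i _; rewrite dotE.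
Qed.

Lemma dot_ge0 u : 0 <= dot u u.
Proof. by apply: sumr_ge0 => k _; rewrite -expr2 sqr_ge0. Qed.

Lemma enorm_ge0 u : 0 <= enorm u.
Proof. exact: sqrtr_ge0. Qed.

Lemma sqr_enorm u : enorm u ^+ 2 = dot u u.
Proof. by rewrite sqr_sqrtr // dot_ge0. Qed.

Lemma enorm_gt0 u : u != 0 -> 0 < enorm u.
Proof.
move=> u0; rewrite sqrtr_gt0 lt0r dot_ge0 andbT.
by apply: contra u0 => /eqP/dot_eq0 ->.
Qed.

Lemma dot_sum_orthogonal (I : finType) (P : pred I) (g : I -> 'rV[R]_n)
    (w : I -> R) :
  (forall i j, i != j -> dot (g i) (g j) = 0) ->
  dot (\sum_(i | P i) w i *: g i) (\sum_(i | P i) w i *: g i)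
    = \sum_(i | P i) w i ^+ 2 * dot (g i) (g i).
Proof.
move=> og; rewrite dot_suml; apply: eq_bigr => i Pi.
rewrite dotZl dotC dot_suml (bigD1 i) //= big1 => [|j /andP[_ ji]].
  by rewrite dotZl addr0 expr2 mulrA.
by rewrite dotZl og // mulr0.
Qed.

End Dot.

(** * Gram-Schmidt vectors and projected bases *)

Section GramSchmidt.
Variables (R : realType) (d n : nat) (B : 'M[R]_(d, n)).

Lemma row_gs (i : 'I_d) :
  row i B = gs B i + \sum_(j < d | (j < i)%N) gs_mu B i j *: gs B j.
Proof. by rewrite [gs B i]gsE subrK. Qed.

Lemma gs_orthogonal (i j : 'I_d) : i != j -> dot (gs B i) (gs B j) = 0.
Proof.
suff main k (l m : 'I_d) : (l < k)%N -> (m < l)%N -> dot (gs B l) (gs B m) = 0.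
  rewrite -(inj_eq val_inj) /= neq_ltn => /orP[ij|ji].
    by rewrite dotC (main j.+1).
  by rewrite (main i.+1).
elim: k l m => // k IH l m lk ml.
rewrite [gs B l]gsE dotBl dot_suml (bigD1 m) //= big1 => [|h /andP[hl hm]].
  rewrite addr0 dotZl /gs_mu sqr_enorm.
  (* If [gs B m] is zero, the coefficient divides by zero, but both inner products vanish. *)
  have [z|nz] := eqVneq (dot (gs B m) (gs B m)) 0.
    by rewrite (dot_eq0 z) !dot0r mulr0 subr0.
  by rewrite divfK // subrr.
rewrite dotZl; suff -> : dot (gs B h) (gs B m) = 0 by rewrite mulr0.
move: hm; rewrite -(inj_eq val_inj) /= neq_ltn => /orP[hm|mh].
  by rewrite dotC IH //; lia.
by rewrite IH //; lia.
Qed.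

Lemma dot_gs_row (i l : 'I_d) : (l < i)%N -> dot (gs B i) (row l B) = 0.
Proof.
move=> li; rewrite row_gs dotC dotDl dot_suml big1 ?addr0 => [|j jl].
  by apply: gs_orthogonal; rewrite -(inj_eq val_inj) /=; lia.
by rewrite dotZl gs_orthogonal ?mulr0 // -(inj_eq val_inj) /=; lia.
Qed.

(** [B] is a square matrix times the matrix of Gram-Schmidt vectors, so the latter has full row rank
    and no zero row. *)
Lemma gs_neq0 (i : 'I_d) : row_free B -> gs B i != 0.
Proof.
move=> Bfree; apply/eqP => gi0.
pose L : 'M[R]_d := \matrix_(l, j)
  (if (j < l)%N then gs_mu B l j else (l == j)%:R).
have BE : B = L *m \matrix_l gs B l.
  apply/row_matrixP => l; rewrite row_mul mulmx_sum_row row_gs.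
  rewrite [RHS](bigID (fun j : 'I_d => (j < l)%N)) /= [RHS]addrC.
  congr (_ + _).
    rewrite (bigD1 l) ?ltnn //= !mxE ltnn eqxx scale1r rowK big1 ?addr0 //.
    move=> j /andP[jl nlj]; rewrite !mxE (negbTE jl) eq_sym (negbTE nlj).
    by rewrite scale0r.
  by apply: eq_bigr => j jl; rewrite !mxE jl rowK.
have : row_free (\matrix_l gs B l).
  rewrite /row_free eqn_leq rank_leq_row /=.
  by have := mxrankM_maxr L (\matrix_l gs B l); rewrite -BE (eqP Bfree).
apply/negP/row_freePn; exists i.
by rewrite rowK gi0 sub0mx.
Qed.

(** By induction along the recursion, [gs B j] lies in the span of the first [k] rows. *)
Lemma gs_proj_low (k : nat) (j : 'I_d) : (j < k)%N ->
  gs B j *m orthoproj (first_rows B k) = 0.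
Proof.
move=> jk; apply: proj_mx_0; first exact: kermx_cap0.
rewrite genmxE.
suff main m (l : 'I_d) : (l < m)%N -> (l < k)%N ->
    (gs B l <= first_rows B k)%MS by exact: (main j.+1).
elim: m l => // m IH l lm lk; rewrite gsE.
apply: addmx_sub.
  have -> : row l B = row l (first_rows B k) by rewrite rowK lk.
  exact: row_sub.
rewrite eqmx_opp; apply: summx_sub => h hl.
by rewrite scalemx_sub // IH //; lia.
Qed.

Lemma gs_proj_high (k : nat) (j : 'I_d) : (k <= j)%N ->
  gs B j *m orthoproj (first_rows B k) = gs B j.
Proof.
move=> kj; apply: proj_mx_id; first exact: kermx_cap0.
apply/sub_kermxP/rowP => l; rewrite !mxE.
have [lk|kl] := ltnP l k.
  transitivity (dot (gs B j) (row l B)); last by apply: dot_gs_row; lia.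
  by apply: eq_bigr => h _; rewrite !mxE lk !mxE.
by apply: big1 => h _; rewrite !mxE ltnNge kl !mxE mulr0.
Qed.

(* Coordinates with respect to this matrix are those, along the [gs B j] with
   [i <= j], of a vector projected orthogonally to the first [i] rows of [B]; on
   the columns [j < i] it is the identity, so that it is invertible. *)
Definition gs_coord (i : 'I_d) : 'M[R]_d :=
  \matrix_(l, j) (if (i <= j < l)%N then gs_mu B l j else (l == j)%:R).

(** The projection kills the Gram-Schmidt components below [k] and fixes the others. *)
Lemma row_proj_basis (k : nat) (l : 'I_d) : (k <= l)%N ->
  row l (proj_basis B k)
    = gs B l + \sum_(j < d | (k <= j < l)%N) gs_mu B l j *: gs B j.
Proof.
move=> kl; rewrite row_mul row_gs mulmxDl gs_proj_high // mulmx_suml.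
congr (_ + _); rewrite (bigID (fun j : 'I_d => (k <= j)%N)) /=.
rewrite [X in _ + X]big1 ?addr0 => [|j /andP[jl jk]]; last first.
  by rewrite -scalemxAl gs_proj_low ?scaler0 // ltnNge.
apply: eq_big => [j|j /andP[jl kj]]; first by rewrite andbC.
by rewrite -scalemxAl gs_proj_high.
Qed.

Lemma sum_proj_basis (i : 'I_d) (x : 'rV[R]_d) :
  (forall j : 'I_d, (j < i)%N -> x 0 j = 0) ->
  \sum_(l < d | (i <= l)%N) x 0 l *: row l (proj_basis B i)
    = \sum_(j < d | (i <= j)%N) (x *m gs_coord i) 0 j *: gs B j.
Proof.
move=> x0.
under [RHS]eq_bigr => j _ do rewrite mxE scaler_suml.
rewrite exchange_big /= [RHS](bigID (fun l : 'I_d => (i <= l)%N)) /=.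
rewrite [X in _ + X]big1 ?addr0 => [|l il]; last first.
  by apply: big1 => j _; rewrite x0 ?ltnNge // mul0r scale0r.
apply: eq_bigr => l il; rewrite row_proj_basis // scalerDr scaler_sumr.
rewrite [RHS](bigID (fun j : 'I_d => (j < l)%N)) /= [LHS]addrC.
congr (_ + _).
  by apply: eq_bigr => j /andP[ij jl]; rewrite mxE ij jl /= scalerA.
rewrite (bigD1 l) /= ?il ?ltnn // mxE ltnn andbF eqxx mulr1 big1 ?addr0 //.
move=> j /andP[/andP[ij jl] nlj]; rewrite mxE (negbTE jl) andbF eq_sym.
by rewrite (negbTE nlj) mulr0 scale0r.
Qed.

Lemma enorm_sum_gs (i : 'I_d) (w : 'rV[R]_d) :
  enorm (\sum_(j < d | (i <= j)%N) w 0 j *: gs B j) ^+ 2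
    = \sum_(j < d | (i <= j)%N) (`|w 0 j| * enorm (gs B j)) ^+ 2.
Proof.
rewrite sqr_enorm dot_sum_orthogonal; last exact: gs_orthogonal.
by apply: eq_bigr => j _; rewrite exprMn real_normK ?num_real // sqr_enorm.
Qed.

End GramSchmidt.

(** * Integer vectors under a unitriangular change of coordinates *)

Section UnitriangularRounding.
Variables (R : realType) (d : nat) (A : 'M[R]_d).
Hypothesis A_lower : forall l j : 'I_d, (l < j)%N -> A l j = 0.
Hypothesis A_diag : forall j, A j j = 1.

Lemma unitriangular_unit : A \in unitmx.
Proof.
rewrite unitmxE det_trig; last by apply/is_trig_mxP.
by rewrite big1 // unitr1.
Qed.

(** [A] is invertible, so a bound on [x *m A] yields one on [x]. *)
Lemma finite_int_box (M : R) :
  finite_set [set x : 'rV[int]_d |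
    forall j, `|(map_mx intr x *m A) 0 j| <= M].
Proof.
(* Summing over all entries of the inverse gives one bound [N] valid for every [|x_j|]; [f] lists
   the integer vectors with entries between [-N] and [N]. *)
pose N := Num.truncn (\sum_j \sum_l M * `|invmx A l j|).
pose f (y : 'rV['I_(N.*2.+1)]_d) : 'rV[int]_d :=
  \row_j ((y 0 j : nat)%:Z - N%:Z).
suff sub : [set x : 'rV[int]_d | forall j, `|(map_mx intr x *m A) 0 j| <= M]
    `<=` range f.
  exact: sub_finite_set sub (finite_image f finite_finset).
move=> x /= xM; have bnd j : (`|x 0%R j| <= N)%N.
  have M0 : 0 <= M by apply: le_trans (xM j).
  rewrite truncn_ge_nat; last first.
    by do 2![apply: sumr_ge0 => ? _]; rewrite mulr_ge0.
  have := congr1 (fun y => `|(y : 'rV[R]_d) 0 j|)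
            (mulmxK unitriangular_unit (map_mx intr x)).
  rewrite /= [X in _ = `|X|]mxE -intr_norm -natr_absz => <-.
  rewrite mxE; apply: le_trans (ler_norm_sum _ _ _) _.
  rewrite [X in _ <= X](bigD1 j) //= -[X in X <= _]addr0; apply: lerD.
    by apply: ler_sum => l _; rewrite normrM ler_wpM2r.
  by do 2![apply: sumr_ge0 => ? _]; rewrite mulr_ge0.
exists (\row_j inord `|(x 0 j + N%:Z)%R|%N) => //.
apply/rowP => j; rewrite !mxE inordK; have := bnd j; lia.
Qed.

(** Back substitution: coordinate [j] of [x *m A] is [x_j] plus a combination of the [x_l] with
    [l > j], so an integer change of [x_j] corrects its floor without disturbing later
    coordinates. *)
Lemma unitriangular_floor (k : 'I_d -> int) :
  exists x : 'rV[int]_d, forall j, Num.floor ((map_mx intr x *m A) 0 j) = k j.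
Proof.
suff main m : exists x : 'rV[int]_d, forall j : 'I_d, (d <= j + m)%N ->
    Num.floor ((map_mx intr x *m A) 0 j) = k j.
  have [x xk] := main d; exists x => j; apply: xk; exact: leq_addl.
elim: m => [|m [x IH]]; first by exists 0 => j; have := ltn_ord j; lia.
have [md|dm] := ltnP m d; last by exists x => j _; apply: IH; lia.
have hd : (d - m.+1 < d)%N by lia.
pose h := Ordinal hd; pose t := k h - Num.floor ((map_mx intr x *m A) 0 h).
exists (x + t *: delta_mx 0 h) => j dj.
have -> : (map_mx intr (x + t *: delta_mx 0 h) *m A) 0 j
    = (map_mx intr x *m A) 0 j + t%:~R * A h j :> R.
  rewrite map_mxD map_mxZ map_delta_mx mulmxDl -scalemxAl -rowE !mxE //.
have [jh|jh] := eqVneq j h.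
  rewrite jh A_diag mulr1 floorDrz ?intr_int // intrKfloor /t; ring.
have hj : (h < j)%N by move: jh; rewrite -(inj_eq val_inj) /= => /eqP; lia.
by rewrite A_lower // mulr0 addr0 IH //=; move: hj => /=; lia.
Qed.

End UnitriangularRounding.

(** * Counting the enumerated points *)

Section Enumeration.
Variables (R : realType) (d n : nat) (B : 'M[R]_(d.+1, n)).
Hypothesis Bfree : row_free B.

Let gs_gt0 (j : 'I_d.+1) : 0 < enorm (gs B j).
Proof. exact/enorm_gt0/gs_neq0. Qed.

Lemma gs_coord_lower (i l j : 'I_d.+1) : (l < j)%N -> gs_coord B i l j = 0.
Proof.
move=> lj; rewrite mxE ltnNge (ltnW lj) andbF -(inj_eq val_inj) /=.
by rewrite ltn_eqF.
Qed.

Lemma gs_coord_diag (i j : 'I_d.+1) : gs_coord B i j j = 1.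
Proof. by rewrite mxE ltnn andbF eqxx. Qed.

Lemma gs_coord_low (i j : 'I_d.+1) (x : 'rV[R]_d.+1) : (j < i)%N ->
  (x *m gs_coord B i) 0 j = x 0 j.
Proof.
move=> ji; rewrite mxE (bigD1 j) //= gs_coord_diag mulr1 big1 ?addr0 //.
by move=> l lj; rewrite mxE leqNgt ji /= (negbTE lj) mulr0.
Qed.

(** In the orthogonal Gram-Schmidt frame the norm condition becomes an ellipsoid with half-axes
    [|b_1| / |b_j^*|]. *)
Lemma enum_pointsP (i : 'I_d.+1) (x : 'rV[int]_d.+1) :
  enum_points B (i, x) <->
    (forall j : 'I_d.+1, (j < i)%N -> x 0 j = 0) /\
    \sum_(j < d.+1 | (i <= j)%N)
      (`|(map_mx intr x *m gs_coord B i) 0 j| * enorm (gs B j)) ^+ 2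
      <= enorm (row ord0 B) ^+ 2.
Proof.
suff normE : (forall j : 'I_d.+1, (j < i)%N -> x 0 j = 0) ->
    enorm (\sum_(j < d.+1 | (i <= j)%N)
             (x 0 j)%:~R *: row j (proj_basis B i)) ^+ 2
    = \sum_(j < d.+1 | (i <= j)%N)
        (`|(map_mx intr x *m gs_coord B i) 0 j| * enorm (gs B j)) ^+ 2.
  rewrite /enum_points /=; split=> -[x0 le]; split=> //.
    by rewrite -normE // ler_sqr // nnegrE enorm_ge0.
  by rewrite -ler_sqr ?nnegrE ?enorm_ge0 // normE.
move=> x0; rewrite -enorm_sum_gs -sum_proj_basis => [|j ji]; last first.
  by rewrite mxE x0.
by do 2![congr (_ ^+ _) || congr enorm]; apply: eq_bigr => j _; rewrite mxE.
Qed.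

Lemma finite_enum_points : finite_set (enum_points B).
Proof.
pose M := \sum_j enorm (row ord0 B) / enorm (gs B j).
pose S i := [set x : 'rV[int]_d.+1 |
  forall j, `|(map_mx intr x *m gs_coord B i) 0 j| <= M].
apply: (@sub_finite_set _ _ (\bigcup_(i in [set: 'I_d.+1]) (pair i @` S i))).
  move=> [i x] /enum_pointsP[x0 le]; exists i => //; exists x => // j.
  have term0 (l : 'I_d.+1) : 0 <= enorm (row ord0 B) / enorm (gs B l).
    by rewrite divr_ge0 ?enorm_ge0.
  have [ij|ji] := leqP i j; last first.
    by rewrite gs_coord_low // mxE x0 // normr0; apply: sumr_ge0.
  apply: (@le_trans _ _ (enorm (row ord0 B) / enorm (gs B j))).
    rewrite ler_pdivlMr ?gs_gt0 // -ler_sqr ?nnegrE ?enorm_ge0 //; last first.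
      by rewrite mulr_ge0 ?enorm_ge0.
    apply: le_trans le; rewrite (bigD1 j) //= lerDl.
    by apply: sumr_ge0 => l _; rewrite sqr_ge0.
  by rewrite /M (bigD1 j) //= lerDl; apply: sumr_ge0.
apply: bigcup_finite => [|i _]; first exact: finite_finset.
apply: finite_image; apply: finite_int_box; last exact: gs_coord_diag.
exact: gs_coord_lower.
Qed.

(** The zero vector is always visited; this settles dimensions too small for the asymptotic
    estimate. *)
Lemma num_points_ge1 : (1 <= num_points B)%N.
Proof.
rewrite cardfs_gt0; apply/fset0Pn; exists (ord0, 0).
rewrite in_fset_set ?inE; last exact: finite_enum_points.
apply/enum_pointsP; split=> [j|]; first by rewrite ltn0.
rewrite map_mx0 mul0mx big1 ?sqr_ge0 // => j _.
by rewrite mxE normr0 mul0r expr0n.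
Qed.

(* Choosing the coordinates along [gs B j] from the last one down, each of them
   ranges over all the integers up to a shift; the floors of these coordinates
   can therefore be prescribed freely, and they determine the point. *)
Lemma num_points_ge (i : 'I_d.+1) (N : 'I_d.+1 -> nat) :
  (forall j, (N j)%:R * enorm (gs B j)
               <= enorm (row ord0 B) / Num.sqrt d.+1%:R) ->
  (\prod_(j < d.+1 | (i <= j)%N) N j <= num_points B)%N.
Proof.
(* A single value is allowed below [i], so the functions [f] are counted by the product over
   [j >= i]. *)
move=> NB; pose N' (j : 'I_d.+1) := if (i <= j)%N then N j else 1%N.
have := unitriangular_floor (@gs_coord_lower i) (gs_coord_diag i).
move=> /(_ _)/cid-/all_sig[X XP].
pose k (f : {dffun forall j, 'I_(N' j)}) (j : 'I_d.+1) : int := (f j : nat)%:Z.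
pose F f := (i, X (k f)).
have Finj : injective F.
  move=> f g [fg]; apply/ffunP => j; apply: val_inj.
  by have := XP (k f) j; rewrite fg XP /k => -[].
have -> : (\prod_(j < d.+1 | (i <= j)%N) N j)%N = 
      size (map F (enum {dffun forall j, 'I_(N' j)})).
  rewrite size_map -cardE card_dep_ffun foldrE big_image /=.
  by rewrite big_mkcond; apply: eq_bigr => j _; rewrite card_ord.
apply: uniq_leq_size; first by rewrite map_inj_uniq ?enum_uniq.
move=> _ /mapP[f _ ->].
rewrite in_fset_set ?inE; last exact: finite_enum_points.
set x := map_mx intr (X (k f)) *m gs_coord B i.
have xitv j : (f j : nat)%:R <= x 0 j < (f j : nat)%:R + 1.
  have := floor_itv (x 0 j); rewrite XP intrD; exact.
apply/enum_pointsP; split=> [j ji|].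
  apply/eqP; rewrite -(intr_eq0 R).
  (* Below [i] the coordinate is the integer [x_j] itself, with prescribed floor 0. *)
  have : (X (k f) 0 j)%:~R = x 0 j by rewrite /x gs_coord_low // mxE.
  have := XP (k f) j; rewrite -/x => + xE; rewrite -xE intrKfloor => ->.
  rewrite /k; suff /eqP-> : (f j : nat) == 0%N by [].
  have N'1 : (N' j <= 1)%N by rewrite /N' (leqNgt i j) ji.
  by rewrite -leqn0 -ltnS (leq_trans (ltn_ord (f j))).
(* Each of the [d.+1] directions gets an equal share of [|b_1|^2], whence the square root in the
   hypothesis. *)
apply: (@le_trans _ _ (\sum_(j < d.+1) enorm (row ord0 B) ^+ 2 / d.+1%:R)).
  rewrite [X in _ <= X](bigID (fun j : 'I_d.+1 => (i <= j)%N)) /=.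
  rewrite -[X in X <= _]addr0; apply: lerD; last first.
    by apply: sumr_ge0 => j _; rewrite divr_ge0 ?sqr_ge0.
  apply: ler_sum => j ij.
  rewrite -[d.+1%:R in X in _ <= X]sqr_sqrtr // -expr_div_n.
  rewrite ler_sqr ?nnegrE ?divr_ge0 ?mulr_ge0 ?enorm_ge0 ?sqrtr_ge0 //.
  apply: le_trans (NB j); rewrite ler_wpM2r ?enorm_ge0 //.
  have /andP[x1 x2] := xitv j; rewrite ger0_norm; last exact: le_trans x1.
  apply: le_trans (ltW x2) _; rewrite natr1 ler_nat.
  have N'N : (N' j <= N j)%N by rewrite /N' ij.
  exact: leq_trans (ltn_ord (f j)) N'N.
by rewrite sumr_const card_ord -[leLHS]mulr_natr divfK // pnatr_eq0.
Qed.

(** This loss, once per coordinate, is the source of the power of 2 in the theorem. *)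
Lemma half_le_truncn (r : R) : 1 <= r -> r / 2 <= (Num.truncn r)%:R.
Proof.
move=> r1; have := truncnS_gt r; rewrite -natr1.
have : 1 <= (Num.truncn r)%:R :> R by rewrite ler1n truncn_gt0.
lra.
Qed.

Lemma num_points_ge_prod (i : 'I_d.+1) :
  (forall j : 'I_d.+1, (i <= j)%N ->
     enorm (gs B j) <= enorm (row ord0 B) / Num.sqrt d.+1%:R) ->
  \prod_(j < d.+1 | (i <= j)%N)
      (enorm (row ord0 B) / (Num.sqrt d.+1%:R * enorm (gs B j)) / 2)
    <= (num_points B)%:R.
Proof.
move=> gsB.
pose r j := enorm (row ord0 B) / (Num.sqrt d.+1%:R * enorm (gs B j)).
have s0 : 0 < Num.sqrt d.+1%:R :> R by rewrite sqrtr_gt0.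
have r1 (j : 'I_d.+1) : (i <= j)%N -> 1 <= r j.
  move=> ij; rewrite ler_pdivlMr ?mulr_gt0 // mul1r mulrC.
  by rewrite -ler_pdivlMr // gsB.
have := @num_points_ge i (fun j => Num.truncn (r j)).
rewrite -(ler_nat R) natr_prod => npB; apply: le_trans (npB _).
  apply: ler_prod => j ij; rewrite half_le_truncn ?r1 // andbT.
  by rewrite divr_ge0 // ltW // (lt_le_trans _ (r1 j ij)).
move=> j; rewrite -ler_pdivlMr //.
have -> : enorm (row ord0 B) / Num.sqrt d.+1%:R / enorm (gs B j) = r j.
  by rewrite /r invfM mulrA.
by rewrite truncn_le divr_ge0 ?enorm_ge0 // mulr_ge0 // ltW.
Qed.

End Enumeration.

(** * Elementary bounds on logarithms and their sums *)

Section LogSums.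
Variable R : realType.
Implicit Types x y : R.

Lemma ln_sub_le x y : 0 < x -> 0 < y -> ln x - ln y <= x / y - 1.
Proof.
move=> x0 y0; rewrite -ln_div //.
have xy : 0 < x / y by rewrite divr_gt0.
have := @le_ln1Dx R (x / y - 1); rewrite addrCA subrr addr0; apply; lra.
Qed.

Lemma ln_succ_sub_le (q : nat) : (0 < q)%N ->
  ln q.+1%:R - ln q%:R <= q%:R^-1 :> R.
Proof.
move=> q0; apply: le_trans (ln_sub_le _ _) _; rewrite ?ltr0n //.
by rewrite -natr1 mulrDl divff ?pnatr_eq0 -?lt0n // mul1r addrC addKr.
Qed.

Lemma ln_succ_sub_ge (q : nat) : (0 < q)%N ->
  q.+1%:R^-1 <= ln q.+1%:R - ln q%:R :> R.
Proof.
move=> q0; rewrite -lerN2 opprB.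
apply: le_trans (ln_sub_le _ _) _; rewrite ?ltr0n //.
have : q.+1%:R * q.+1%:R^-1 = 1 :> R by rewrite divff ?pnatr_eq0.
by set u := q.+1%:R^-1; rewrite -natr1; lra.
Qed.

(** Upper half of Stirling's formula; the inductive step is [1 <= (m + 1) (ln (m + 1) - ln m)]. *)
Lemma sum_ln_le (m : nat) : (0 < m)%N ->
  \sum_(k < m) ln k.+1%:R <= m%:R * ln m%:R - m%:R + ln m%:R + 1 :> R.
Proof.
case: m => // m _; elim: m => [|m IH].
  by rewrite big_ord1 ln1; lra.
rewrite big_ord_recr /=.
have := @ln_succ_sub_ge m.+1 isT.
rewrite -[X in X <= _]mul1r ler_pdivrMr ?ltr0n // -[m.+2%:R]natr1.
move: IH; set s := \sum_(_ < _) _; nra.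
Qed.

Lemma sum_sqrt_inv_le (m : nat) :
  \sum_(k < m) (Num.sqrt k.+1%:R)^-1 <= 2 * Num.sqrt m%:R :> R.
Proof.
elim: m => [|m IH]; first by rewrite big_ord0 sqrtr0 mulr0.
rewrite big_ord_recr /=.
set s := Num.sqrt m.+1%:R; set t := Num.sqrt m%:R in IH *.
have s0 : 0 < s by rewrite sqrtr_gt0.
have sE : s ^+ 2 = m%:R + 1 by rewrite sqr_sqrtr // natr1.
have tE : t ^+ 2 = m%:R by rewrite sqr_sqrtr.
have : s^-1 <= 2 * (s - t).
  by rewrite -[X in X <= _]mul1r ler_pdivrMr //; nra.
move: IH; set u := \sum_(_ < _) _; lra.
Qed.

Lemma sqr_le_expR_half x : 0 <= x -> x ^+ 2 <= 8 * expR (x / 2).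
Proof.
move=> x0; have := @expR_ge1Dxn R (x / 2) 1; rewrite !factS fact0 /=.
move=> /(_ ltac:(by rewrite divr_ge0)); nra.
Qed.

(** By [sqr_le_expR_half], the square of [ln (D / k)] is at most [8 sqrt (D / k)], and the sum of
    [1 / sqrt k] is at most [2 sqrt D]. *)
Lemma sum_sqr_ln_le (D m : nat) : (0 < D)%N -> (m <= D)%N ->
  \sum_(k < m) (ln D%:R - ln k.+1%:R) ^+ 2 <= 16 * D%:R :> R.
Proof.
move=> D0 mD.
have sD : 0 < Num.sqrt D%:R :> R by rewrite sqrtr_gt0 ltr0n.
apply: (@le_trans _ _
  (8 * Num.sqrt D%:R * \sum_(k < m) (Num.sqrt k.+1%:R)^-1)).
  rewrite mulr_sumr; apply: ler_sum => k _.
  have kD : (k < D)%N by exact: leq_trans (ltn_ord k) mD.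
  apply: le_trans (sqr_le_expR_half _) _.
    by rewrite subr_ge0 ler_ln ?posrE ?ltr0n // ler_nat.
  rewrite -mulrA ler_wpM2l // -ln_div ?posrE ?ltr0n // -powR12_sqrt //.
  rewrite -powR12_sqrt // -powRN -[X in _ <= _ * X]mul1r.
  rewrite /powR !pnatr_eq0 (gtn_eqF D0) /= mul1r -expRD ler_expR.
  rewrite ln_div ?posrE ?ltr0n //; lra.
apply: (@le_trans _ _ (8 * Num.sqrt D%:R * (2 * Num.sqrt D%:R))).
  rewrite ler_wpM2l ?mulr_ge0 ?(ltW sD) //.
  apply: le_trans (sum_sqrt_inv_le m) _.
  by rewrite ler_wpM2l // ler_sqrt ?ler0n // ler_nat.
rewrite mulrACA -expr2 sqr_sqrtr ?ler0n //; lra.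
Qed.

(** Rows being counted from 0, [D - j] is the number of rows from [j] on. *)
Lemma sum_rev_tail (D m : nat) (G : nat -> R) : (m <= D)%N ->
  \sum_(j < D | (D - m <= j)%N) G (D - j)%N = \sum_(k < m) G k.+1.
Proof.
move=> mD; rewrite (big_ord_widen D (fun k => G k.+1) mD).
rewrite -(big_mkord (fun j => D - m <= j)%N (fun j => G (D - j)%N)).
rewrite big_nat_rev big_mkord; apply: eq_big => [j|j _].
  by have := ltn_ord j; lia.
by congr G; have := ltn_ord j; lia.
Qed.

End LogSums.

(** * Logarithmic decay of the bad profile *)

Section BadProfile.
Variable R : realType.

Lemma ln_sqrt (x : R) : 0 < x -> ln (Num.sqrt x) = ln x / 2.
Proof. by move=> x0; rewrite -powR12_sqrt ?ltW // ln_powR mulrC. Qed.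

Lemma bad_profile_gt0 (D i : nat) : 0 < bad_profile R D i.
Proof.
rewrite mulr_gt0 ?sqrtr_gt0 ?ltr0n ?addn1 //.
apply: prodr_gt0 => l _; rewrite powR_gt0 // mulr_gt0 ?expR_gt0 //.
Qed.

(* A lower bound for the increments of m |-> ln |b_{D-m+1}^*|; its leading term
   comes from sum_{q < m} ln (q + 1) / (2 q) ~ (ln m)^2 / 4. *)
Definition profile_potential (m : nat) : R :=
  ln m%:R / 2 + ln m%:R ^+ 2 / 4 - 6 * ln m%:R.

Lemma bad_profile_succ (D i : nat) : (i < D)%N ->
  bad_profile R D i * Num.sqrt (D - i)%:R =
  bad_profile R D i.+1 * Num.sqrt (D - i).+1%:R *
    (expR (- 6) * (D - i).+1%:R) `^ (1 / (2 * (D - i)%:R)).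
Proof.
move=> iD; rewrite /bad_profile big_ltn; last by rewrite !addn1.
rewrite !addn1.
rewrite (_ : (D - i.+1 + 2 = (D - i).+1)%N); last by lia.
rewrite (_ : ((D - i.+1).+1 = D - i)%N); last by lia.
ring.
Qed.

Lemma ln_bad_profile_succ (D i : nat) : (i < D)%N ->
  profile_potential (D - i).+1 - profile_potential (D - i)
    <= ln (bad_profile R D i) - ln (bad_profile R D i.+1).
Proof.
move=> iD; set q := (D - i)%N; have q0 : (0 < q)%N by rewrite subn_gt0.
have qR : 0 < q%:R :> R by rewrite ltr0n.
move: (bad_profile_gt0 D i) (bad_profile_gt0 D i.+1) (bad_profile_succ iD).
rewrite -/q; move: (bad_profile R D i) (bad_profile R D i.+1) => P Q P0 Q0.
move=> /(congr1 (@ln R)).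
rewrite !lnM ?posrE ?mulr_gt0 ?sqrtr_gt0 ?powR_gt0 ?mulr_gt0 ?expR_gt0 ?ltr0n //.
rewrite !ln_sqrt ?ltr0n // ln_powR lnM ?posrE ?expR_gt0 ?ltr0n // expRK.
have := @ln_succ_sub_le R q q0; have := @ln_succ_sub_ge R q q0.
have : (2 * q%:R)^-1 <= q.+1%:R^-1 :> R.
  rewrite lef_pV2 ?posrE ?mulr_gt0 ?ltr0n //.
  by rewrite -natrM ler_nat mul2n -addnn -addn1 leq_add2l.
rewrite /profile_potential invfM mul1r.
have b0 : 0 <= ln q%:R :> R by rewrite ln_ge0 // ler1n.
have : 0 < q%:R^-1 :> R by rewrite invr_gt0.
set a := ln q.+1%:R; set b := ln q%:R in b0 *; set u := q%:R^-1.
set v := q.+1%:R^-1.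
move=> u0 u2 au ub E.
have {E} -> : ln P - ln Q = (a - b) / 2 + (2^-1 * u * (- 6 + a)) by lra.
(* This bounds the quadratic increment [(a^2 - b^2) / 4] by [u a / 2]. From [u / 2 <= v <= a - b],
   the increment [-6 (a - b)] is at most [-3 u], the contribution of [C]. *)
have : (a - b) * (a + b) <= u * (2 * a).
  by apply: ler_pM; lra.
lra.
Qed.

Lemma ln_bad_profile_sub (D i : nat) : (i < D)%N ->
  profile_potential D - profile_potential (D - i)
    <= ln (bad_profile R D 1) - ln (bad_profile R D i.+1).
Proof.
elim: i => [|i IH] iD; first by rewrite subn0 !subrr.
have := IH (ltnW iD); have := ln_bad_profile_succ iD.
rewrite (_ : ((D - i.+1).+1 = D - i)%N); last by lia.
lra.
Qed.

End BadProfile.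

(** * Lower bound per coordinate, and its sum *)

Section Gain.
Variable R : realType.
Implicit Types L T : R.

(* A lower bound for ln (|b_1| / (sqrt d |b_j^*|)) on the bad basis, where
   L = ln d and T = ln (d / (d - j + 1)). *)
Definition gain L T : R := L * (T - 1) / 2 - T ^+ 2 / 4 - 11 / 2 * T.

(** Substituting [L - T] for [ln (D - i)] in the potential difference and subtracting [L / 2] for
    [sqrt D] gives exactly [gain L T]. *)
Lemma gain_le_ln (D i : nat) : (i < D)%N ->
  gain (ln D%:R) (ln D%:R - ln (D - i)%:R) <=
    ln (bad_profile R D 1 / (Num.sqrt D%:R * bad_profile R D i.+1)).
Proof.
move=> iD; have D0 : (0 < D)%N by exact: leq_ltn_trans iD.
have sD : 0 < Num.sqrt D%:R :> R by rewrite sqrtr_gt0 ltr0n.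
rewrite ln_div ?posrE ?(bad_profile_gt0, mulr_gt0) //.
rewrite [ln (Num.sqrt _ * _)]lnM ?posrE ?bad_profile_gt0 //.
rewrite ln_sqrt ?ltr0n //; have := ln_bad_profile_sub R iD.
rewrite /gain /profile_potential; lra.
Qed.

Lemma gain_ge0 L T : 800 <= L -> 1 + 38 / L <= T -> T <= L -> 0 <= gain L T.
Proof.
move=> L800 T1 TL; have L0 : 0 < L by lra.
have {}T1 : 38 <= L * (T - 1) by rewrite -ler_pdivrMl // mulrC; lra.
have T0 : 0 <= T by rewrite -(pmulr_rge0 _ L0); lra.
(* For [T <= 3] the constant 38 gives [L (T - 1) / 2 >= 19], which exceeds [9 / 4 + 33 / 2]. For
   [T >= 3], [T^2 <= T L] and [L <= T L / 3] leave [T L / 12 - 11 T / 2]. *)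
rewrite /gain; have [T3|/ltW T3] := leP T 3.
  have : T * T <= 3 * 3 by rewrite ler_pM.
  lra.
have : T * T <= T * L by rewrite ler_wpM2l //; lra.
have : 3 * L <= T * L by rewrite ler_wpM2r; lra.
have : T * 800 <= T * L by rewrite ler_wpM2l //; lra.
lra.
Qed.

Lemma sum_gain_ge (D : nat) (L : R := ln D%:R)
    (m := Num.truncn (D%:R * expR (- (1 + 38 / L)))) : 800 <= L ->
  D%:R * L / (2 * expR 1) - 200 * D%:R
    <= \sum_(k < m) (gain L (L - ln k.+1%:R) - 1).
Proof.
move=> L800; have L0 : 0 < L by lra.
have D0 : (0 < D)%N.
  by rewrite lt0n; apply: contraTneq L0 => D0; rewrite /L D0 ln0 ?ltxx.
have DR : 0 < D%:R :> R by rewrite ltr0n.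
have DE : expR L = D%:R by rewrite lnK ?posrE.
have e1 : expR (-1) <= 1 :> R by rewrite expR_le1; lra.
have e0 : 0 < expR (-1) :> R := expR_gt0 _.
pose s : R := D%:R * expR (- (1 + 38 / L)).
have s0 : 0 <= s by rewrite mulr_ge0 ?expR_ge0 ?ltW.
have sE : s = expR (L - (1 + 38 / L)) by rewrite expRD DE.
have L38 : 38 / L <= 1 by rewrite ler_pdivrMr; lra.
have L380 : 0 <= 38 / L by rewrite divr_ge0; lra.
have mD : (m <= D)%N.
  rewrite -(ler_nat R); apply: le_trans (_ : s <= _).
    by rewrite truncn_le.
  by rewrite sE -DE ler_expR; lra.
have m0 : (0 < m)%N.
  by rewrite truncn_gt0 -/s sE -[leLHS](expR0 R) ler_expR; lra.
have lnm : ln m%:R <= L - (1 + 38 / L).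
  rewrite -ler_expR -sE lnK ?posrE ?ltr0n //.
  by rewrite truncn_le.
have mge : D%:R * (expR (-1) * (1 - 38 / L)) - 1 <= m%:R.
  have := truncnS_gt s; rewrite -/m -natr1 => sm.
  suff : D%:R * (expR (-1) * (1 - 38 / L)) <= s by lra.
  rewrite /s opprD expRD; do 2![apply: ler_wpM2l; first exact: ltW].
  have := expR_ge1Dx (- (38 / L)); lra.
have LD : L <= D%:R by rewrite -DE; have := expR_ge1Dx L; lra.
have L2D : L ^+ 2 / 2 <= D%:R.
  have := @expR_ge1Dxn R L 1; rewrite !factS fact0 /= DE.
  by move=> /(_ (ltW L0)); lra.
have sq := @sum_sqr_ln_le R _ _ D0 mD; have sl := @sum_ln_le R _ m0.
have {}mD : m%:R <= D%:R :> R by rewrite ler_nat.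
(* The lower-order terms are absorbed into [6 T^2 + 7] through [2 T <= T^2 + 1]. *)
apply: (@le_trans _ _ (L / 2 * (m%:R * (L - 1) - \sum_(k < m) ln k.+1%:R)
  - 6 * \sum_(k < m) (L - ln k.+1%:R) ^+ 2 - 7 * m%:R)); last first.
  rewrite -[m in m%:R * _]card_ord -[m in 7 * m%:R]card_ord.
  rewrite mulr_natl -mulr_natr -!sumr_const -sumrB !mulr_sumr -!sumrB.
  apply: ler_sum => k _; rewrite /gain mul1r mulr1.
  have := sqr_ge0 (L - ln k.+1%:R); have := sqr_ge0 (L - ln k.+1%:R - 1).
  lra.
rewrite invfM -expRN.
set S := \sum_(k < m) ln _ in sl *; set Q := \sum_(k < m) _ ^+ 2 in sq *.
(* By the choice of [m], [m ln m] is at most [m (L - 1)]; the main term that survives is the [m] of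
   Stirling's formula. *)
have mS : m%:R - L - 1 <= m%:R * (L - 1) - S.
  have : m%:R * ln m%:R <= m%:R * (L - (1 + 38 / L)) by rewrite ler_wpM2l.
  have : 0 <= m%:R * (38 / L) by rewrite mulr_ge0.
  move: lnm; lra.
have LmS : L / 2 * (D%:R * (expR (-1) * (1 - 38 / L)) - 2 - L)
    <= L / 2 * (m%:R * (L - 1) - S).
  by rewrite ler_wpM2l; lra.
(* In units of [D], the losses are at most 19 from [38 / L], 2 from [L + L^2 / 2], 96 from the
   squares and 7 from the constants: 124, below 200. *)
have : L / 2 * (D%:R * (expR (-1) * (38 / L))) = 19 * D%:R * expR (-1).
  by field; rewrite gt_eqF.
have : D%:R * expR (-1) <= D%:R * 1 :> R by rewrite ler_wpM2l // ltW.
rewrite -/Q; move: LmS; set w := L / 2 * (_ - S); lra.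
Qed.

End Gain.

(** * Number of points on the bad basis *)

Section BadBasis.
Variables (R : realType) (d n : nat) (B : 'M[R]_(d.+1, n)).
Hypothesis Bfree : row_free B.
Hypothesis Bprofile :
  forall i : 'I_d.+1, enorm (gs B i) = bad_profile R d.+1 i.+1.

Lemma gs_ord0 : gs B ord0 = row ord0 B.
Proof. by rewrite gsE big_pred0 ?subr0. Qed.

(** The product bound is applied to the last [m] rows, where [D - j <= m] forces [T >= 1 + 38 / L]
    and hence a nonnegative gain. *)
Lemma num_points_bad_profile (L : R := ln d.+1%:R) : 800 <= L ->
  expR (d.+1%:R * L / (2 * expR 1) - 200 * d.+1%:R) <= (num_points B)%:R.
Proof.
set D := d.+1; move=> L800; have L0 : 0 < L by lra.
have DR : 0 < D%:R :> R by rewrite ltr0n.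
have DE : expR L = D%:R by rewrite lnK ?posrE.
pose s := D%:R * expR (- (1 + 38 / L)); pose m := Num.truncn s.
have sE : s = expR (L - (1 + 38 / L)) by rewrite expRD DE.
have L380 : 0 <= 38 / L by rewrite divr_ge0; lra.
have L38 : 38 / L <= 1 by rewrite ler_pdivrMr; lra.
have m0 : (0 < m)%N.
  by rewrite truncn_gt0 sE -[leLHS](expR0 R) ler_expR; lra.
have sD : s <= D%:R by rewrite sE -DE ler_expR; lra.
have ms : m%:R <= s by rewrite truncn_le sE expR_ge0.
have mD : (m <= D)%N by rewrite -(ler_nat R) (le_trans ms).
have iD : (D - m < D)%N by rewrite ltn_subrL m0.
have b0E : enorm (row ord0 B) = bad_profile R D 1 by rewrite -gs_ord0 Bprofile.
have sqD : 0 < Num.sqrt D%:R :> R by rewrite sqrtr_gt0.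
pose G k := gain L (L - ln k%:R).
have G_le (j : 'I_D) : expR (G (D - j)%N)
    <= enorm (row ord0 B) / (Num.sqrt D%:R * enorm (gs B j)).
  rewrite b0E Bprofile -ler_ln ?posrE ?expR_gt0 //.
    by rewrite expRK; exact: gain_le_ln.
  by rewrite divr_gt0 ?(bad_profile_gt0, mulr_gt0).
have G_ge0 (j : 'I_D) : (D - m <= j)%N -> 0 <= G (D - j)%N.
  move=> mj; have jD := ltn_ord j.
  have Dj : 0 < (D - j)%:R :> R by rewrite ltr0n subn_gt0.
  apply: gain_ge0 => //.
    suff : ln (D - j)%:R <= L - (1 + 38 / L) by lra.
    rewrite -ler_expR -sE lnK ?posrE //; apply: le_trans ms.
    by rewrite ler_nat leq_subCl.
  have : 0 <= ln (D - j)%:R :> R by rewrite ln_ge0 // ler1n subn_gt0.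
  lra.
apply: le_trans (num_points_ge_prod (i := Ordinal iD) Bfree _); last first.
  move=> j mj; rewrite ler_pdivlMr // mulrC.
  have gj : 0 < Num.sqrt D%:R * enorm (gs B j).
    by rewrite mulr_gt0 // Bprofile bad_profile_gt0.
  rewrite -[leLHS]mul1r -ler_pdivlMr //; apply: le_trans (G_le j).
  by rewrite -[leLHS](expR0 R) ler_expR G_ge0.
apply: (@le_trans _ _ (expR (\sum_(k < m) (G k.+1 - 1)))).
  by rewrite ler_expR sum_gain_ge.
rewrite -(@sum_rev_tail R D m (fun k => G k - 1)) // expR_sum.
apply: ler_prod => j mj; rewrite expR_ge0 /= expRB.
apply: ler_pM; rewrite ?expR_ge0 ?invr_ge0 ?expR_ge0 //.
(* The [- 1] charged to each gain pays for the factor [1 / 2], since [e >= 2]. *)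
by rewrite lef_pV2 ?posrE ?expR_gt0 //; have := expR_ge1Dx (1 : R); lra.
Qed.

End BadBasis.

(** * The correction term and the final theorem *)

Definition kannan_eps (R : realType) (m : nat) : R :=
  - (400 * expR 1) / ln m%:R.

Lemma kannan_eps_cvg (R : realType) :
  kannan_eps R m @[m --> \oo] --> (0 : R).
Proof.
have c0 : 0 < 400 * expR 1 :> R by have := expR_gt0 (1 : R); lra.
apply/cvgrPdist_le => /= e e0.
pose x : R := expR (400 * expR 1 / e).
near=> m.
have xm : x <= m%:R.
  near: m; exact: nbhs_infty_ger.
have m0 : 0 < m%:R :> R by apply: lt_le_trans xm; exact: expR_gt0.
have lnm : 400 * expR 1 / e <= ln m%:R by rewrite -ler_expR lnK.
have l0 : 0 < ln m%:R :> R.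
  by apply: lt_le_trans lnm; exact: divr_gt0.
rewrite sub0r normrN /kannan_eps mulNr normrN ger0_norm; last first.
  by apply: divr_ge0; apply: ltW.
by rewrite ler_pdivrMr // [leRHS]mulrC -ler_pdivrMr.
Unshelve. all: by end_near. Qed.

Lemma powR_kannan_eps_le (R : realType) (d n : nat) (B : 'M[R]_(d.+1, n)) :
  row_free B ->
  (forall i : 'I_d.+1, enorm (gs B i) = bad_profile R d.+1 i.+1) ->
  d.+1%:R `^ (d.+1%:R / (2 * expR 1) * (1 + kannan_eps R d.+1))
    <= (num_points B)%:R.
Proof.
move=> Bfree Bprofile; have np1 := num_points_ge1 Bfree.
have D1 : 1 <= d.+1%:R :> R by rewrite ler1n.
have e2 : 2 <= expR 1 :> R by have := expR_ge1Dx (1 : R); lra.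
rewrite /powR pnatr_eq0 /= /kannan_eps; set L := ln d.+1%:R.
have L0 : 0 <= L by exact: ln_ge0.
(* Dimension 1, where [kannan_eps] divides by zero. *)
have [->|Ln0] := eqVneq L 0; first by rewrite mulr0 expR0 ler1n.
(* The constant [400 * expR 1] makes the correction equal to the loss [200 * d.+1%:R]. *)
have -> : d.+1%:R / (2 * expR 1) * (1 + - (400 * expR 1) / L) * L
    = d.+1%:R * L / (2 * expR 1) - 200 * d.+1%:R.
  by field; rewrite Ln0 gt_eqF ?expR_gt0.
(* As [e >= 2], this threshold is at least 800; below it the exponent is nonpositive and one point
   suffices. *)
have [Lbig|Lsmall] := leP (400 * expR 1) L.
  by apply: num_points_bad_profile => //; apply: le_trans Lbig; lra.
apply: (@le_trans _ _ 1); last by rewrite ler1n.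
rewrite -[leRHS](expR0 R) ler_expR subr_le0 ler_pdivrMr; last by lra.
have : d.+1%:R * L <= d.+1%:R * (400 * expR 1) by rewrite ler_wpM2l // ltW.
lra.
Qed.

Unset Implicit Arguments.

Theorem theorem3 (R : realType) :
  (forall (d n : nat) (B : 'M[R]_(d.+1, n)) (i : 'I_d.+1),
     row_free B ->
     (forall j : 'I_d.+1, (i <= j)%N ->
        enorm (gs B j) <= enorm (row ord0 B) / Num.sqrt d.+1%:R) ->
     2 ^- (d.+1 - i) *
       \prod_(j < d.+1 | (i <= j)%N)
         (enorm (row ord0 B) / (Num.sqrt d.+1%:R * enorm (gs B j)))
     <= (num_points B)%:R)
  /\
  (forall K : kannan_algorithm R,
     exists eps : nat -> R,
       (eps m @[m --> \oo] --> (0 : R)) /\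
       forall (d n : nat) (B : 'M[R]_(d.+1, n)),
         row_free B -> HKZ B ->
         (forall i : 'I_d.+1, enorm (gs B i) = bad_profile R d.+1 i.+1) ->
         d.+1%:R `^ (d.+1%:R / (2 * expR 1) * (1 + eps d.+1))
           <= (operations K B)%:R).
Proof.
split=> [d n B i Bfree gsB|K].
  apply: le_trans (num_points_ge_prod Bfree gsB).
  (* One factor [1 / 2] for each of the [d.+1 - i] rows from [i] on; counting from 1, the exponent
     reads [-d + i - 1]. *)
  rewrite [leRHS]big_split /= [leRHS]mulrC prodr_const exprVn.
  suff -> : #|[pred j : 'I_d.+1 | (i <= j)%N]| = (d.+1 - i)%N by [].
  by rewrite -sum1_card -[RHS]muln1 -sum_nat_const_nat big_geq_mkord.
exists (kannan_eps R); split; first exact: kannan_eps_cvg.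
move=> d n B Bfree BHKZ Bprofile.
apply: le_trans (powR_kannan_eps_le Bfree Bprofile) _.
(* The HKZ-reduced input is its own quasi-reduction, so the enumeration runs on [B] itself. *)
by have := operations_ge K Bfree; rewrite quasi_reduce_id // ler_nat.
Qed.
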